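(* Let $k\ge 0$ and let $L$ be a $k$-DCFL. Then there is a number $n$ such that every word $w\in L$ with $|w|>n$ can be written as $$w=s_0\,y_1u_1z_1\,s_1\,y_2u_2z_2\,s_2\cdots y_lu_lz_l\,s_l$$ for some $l\le k+1$ and words $s_i,y_i,u_i,z_i\in\Sigma^*$, such that: (1) $|y_1z_1\cdots y_lz_l|>0$; (2) $|y_1u_1z_1\cdots y_lu_lz_l|\le n$; (3) for every natural number $p$, the word $s_0y_1^pu_1z_1^ps_1\cdots y_l^pu_lz_l^ps_l$ belongs to $L$.
   Context: Let $\Sigma$ be a finite alphabet and $1\notin\Sigma$ a distinguished separator; $\Sigma_1=\Sigma\cup\{1\}$. The rank of $w\in\Sigma_1^*$ is $\mathrm{rk}(w)=|w|_1$. For $u,v\in\Sigma_1^*$ with $\mathrm{rk}(u)\ge j$, the $j$-th intercalation $u\odot_j v$ is the word obtained from $u$ by replacing the $j$-th occurrence of $1$ by $v$. Let $N$ be a finite set of nonterminals with a rank function $\mathrm{rk}:N\to\{0,\dots,k\}$. The set $Tm_k$ of $k$-correct terms, each with a rank, is the smallest set such that: each $A\in N$ is a term of rank $\mathrm{rk}(A)$; each $w\in\Sigma^*$ is a term of rank $0$; $1$ is a term of rank $1$; if $\alpha,\beta\in Tm_k$ and $\mathrm{rk}(\alpha)+\mathrm{rk}(\beta)\le k$ then $(\alpha\cdot\beta)$ is a term of rank $\mathrm{rk}(\alpha)+\mathrm{rk}(\beta)$; if $1\le j\le k$, $\mathrm{rk}(\alpha)\ge j$ and $\mathrm{rk}(\alpha)+\mathrm{rk}(\beta)\le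 k+1$ then $(\alpha\odot_j\beta)$ is a term of rank $\mathrm{rk}(\alpha)+\mathrm{rk}(\beta)-1$. A term is ground if it contains no nonterminal; its value is the word of $\Sigma_1^*$ obtained by interpreting $\cdot$ as concatenation and $\odot_j$ as $j$-th intercalation. A context $C[x]$ is a term in which a variable $x$ of fixed rank occurs exactly once as a leaf; $C[\beta]$ denotes the substitution of a term $\beta$ of the same rank for $x$. A $k$-displacement context-free grammar ($k$-DCFG) is $G=\langle N,\Sigma,P,S\rangle$ with $S\in N$, $\mathrm{rk}(S)=0$, and $P$ a finite set of rules $A\to\alpha$ with $A\in N$, $\alpha\in Tm_k$, $\mathrm{rk}(A)=\mathrm{rk}(\alpha)$. Derivability $\vdash_G$ is the smallest reflexive transitive relation between nonterminals and terms such that $(B\to\beta)\in P$ and $A\vdash_G C[B]$ imply $A\vdash_G C[\beta]$ for every context $C$. $L(G)$ is the set of values of ground terms $\alpha$ with $S\vdash_G\alpha$. A $k$-DCFL is a language of the form $L(G)$ for a $k$-DCFG $G$ (over alphabet $\Sigma$). *)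

(* Defs.v *)
From Stdlib Require Import Relation_Operators.
From Stdlib Require List.
From mathcomp Require Import all_boot.
Set Implicit Arguments. Unset Strict Implicit. Unset Printing Implicit Defensive.

Inductive sym (Sigma : Type) := Sep | Sym of Sigma.
Arguments Sep {Sigma}.

Fixpoint intercal (Sigma : Type) (j : nat) (u v : seq (sym Sigma)) : seq (sym Sigma) :=
  match u with
  | [::] => [::]
  | Sep :: u' => if j == 1 then v ++ u' else Sep :: intercal j.-1 u' v
  | a :: u' => a :: intercal j u' v
  end.

Inductive term (Sigma N : Type) :=
  | TN of N
  | TW of seq Sigma
  | TOne
  | TCat of term Sigma N & term Sigma N
  | TInt of nat & term Sigma N & term Sigma N.
Arguments TOne {Sigma N}.
Arguments TN {Sigma N}.
Arguments TW {Sigma N}.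
Arguments TCat {Sigma N}.
Arguments TInt {Sigma N}.

Section Terms.
Variables (Sigma N : Type) (rk : N -> nat) (k : nat).

Fixpoint rank (t : term Sigma N) : nat :=
  match t with
  | TN A => rk A
  | TW _ => 0
  | TOne => 1
  | TCat a b => rank a + rank b
  | TInt _ a b => (rank a + rank b).-1
  end.

(* t is a k-correct term (nonterminal ranks are bounded by k in the grammar). *)
Fixpoint correct (t : term Sigma N) : Prop :=
  match t with
  | TN _ | TW _ | TOne => True
  | TCat a b => [/\ correct a, correct b & rank a + rank b <= k]
  | TInt j a b => [/\ correct a, correct b, 1 <= j <= k, j <= rank a
                    & rank a + rank b <= k.+1]
  end.

Fixpoint ground (t : term Sigma N) : Prop :=
  match t with
  | TN _ => False
  | TW _ | TOne => True
  | TCat a b | TInt _ a b => ground a /\ ground b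
  end.

(* value of a ground term (nonterminals are sent to [::], irrelevant) *)
Fixpoint value (t : term Sigma N) : seq (sym Sigma) :=
  match t with
  | TN _ => [::]
  | TW w => map (@Sym Sigma) w
  | TOne => [:: Sep]
  | TCat a b => value a ++ value b
  | TInt j a b => intercal j (value a) (value b)
  end.

Inductive step (P : seq (N * term Sigma N)) : term Sigma N -> term Sigma N -> Prop :=
  | st_rule B beta : List.In (B, beta) P -> step P (TN B) beta
  | st_catl a a' b : step P a a' -> step P (TCat a b) (TCat a' b)
  | st_catr a b b' : step P b b' -> step P (TCat a b) (TCat a b')
  | st_intl j a a' b : step P a a' -> step P (TInt j a b) (TInt j a' b)
  | st_intr j a b b' : step P b b' -> step P (TInt j a b) (TInt j a b').

Definition derives (P : seq (N * term Sigma N)) (A : N) (t : term Sigma N) : Prop :=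
  clos_refl_trans (term Sigma N) (step P) (TN A) t.

Definition is_kDCFG (P : seq (N * term Sigma N)) (S : N) : Prop :=
  [/\ forall A, rk A <= k,
      rk S = 0
    & forall A alpha, List.In (A, alpha) P -> rank alpha = rk A /\ correct alpha].

Definition lang (P : seq (N * term Sigma N)) (S : N) (w : seq Sigma) : Prop :=
  exists t, [/\ derives P S t, ground t & value t = map (@Sym Sigma) w].

End Terms.

Definition is_kDCFL (k : nat) (Sigma : finType) (L : seq Sigma -> Prop) : Prop :=
  exists (N : finType) (rk : N -> nat) (P : seq (N * term Sigma N)) (S : N),
    is_kDCFG rk k P S /\ forall w, L w <-> lang P S w.

Definition part_y (Sigma : Type) (q : seq Sigma * seq Sigma * seq Sigma * seq Sigma) := q.1.1.1.
Definition part_u (Sigma : Type) (q : seq Sigma * seq Sigma * seq Sigma * seq Sigma) := q.1.1.2.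
Definition part_z (Sigma : Type) (q : seq Sigma * seq Sigma * seq Sigma * seq Sigma) := q.1.2.
Definition part_s (Sigma : Type) (q : seq Sigma * seq Sigma * seq Sigma * seq Sigma) := q.2.

Definition pump (Sigma : Type) (s0 : seq Sigma)
    (parts : seq (seq Sigma * seq Sigma * seq Sigma * seq Sigma)) (p : nat) : seq Sigma :=
  s0 ++ flatten (map (fun q => flatten (nseq p (part_y q)) ++ part_u q
                               ++ flatten (nseq p (part_z q)) ++ part_s q) parts).

(* Main.v *)
Require Import Defs.
From HB Require Import structures.
From Stdlib Require Import Relation_Operators.
From mathcomp Require Import all_boot zify.
Set Implicit Arguments. Unset Strict Implicit. Unset Printing Implicit Defensive.

(* Induction on [k]. Call a nonterminal high if its rank is [k]. The rank
    constraints force every rule step between two high nonterminals to be even: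
    the context keeps each separator of its hole and creates no other one, so
    it surrounds each of the [k + 1] blocks of its argument by fixed words.
    Hence a high nonterminal which repeats along a path of high nonterminals
    yields a pump with [k + 1] blocks, unless it can be shortcut.

    If no high nonterminal repeats in this way, the high parts of the derivation
    have bounded depth. The high part is left upwards only by filling one of its
    separators with a word of rank 0, and by the associativity laws of
    concatenation and intercalation this filling can be pushed down to its
    bottom, where the ranks are smaller. The finitely many terms so
    obtained form a [k - 1]-DCFG, to which the induction hypothesis applies.
    Considering a lowest repetition, all pieces hanging off its path are either
    pumpable or short, which bounds the total length of the pumped part. *)

(** * Terms as a countable type *)

Section TermCountable.
Variables Sigma N : countType.

(** Lists of terms are searched with [\in], and subterms later serve as the nonterminals of a finite
    grammar; both rest on this structure. The labels 0 and 1 are taken, so a position [j] is stored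
    as [j.+2]. *)
Fixpoint term_encode (t : term Sigma N) : GenTree.tree (N + seq Sigma) :=
  match t with
  | TN A => GenTree.Leaf (inl A)
  | TW w => GenTree.Leaf (inr w)
  | TOne => GenTree.Node 0 [::]
  | TCat a b => GenTree.Node 1 [:: term_encode a; term_encode b]
  | TInt j a b => GenTree.Node j.+2 [:: term_encode a; term_encode b]
  end.

Fixpoint term_decode (x : GenTree.tree (N + seq Sigma)) : term Sigma N :=
  match x with
  | GenTree.Leaf (inl A) => TN A
  | GenTree.Leaf (inr w) => TW w
  | GenTree.Node 1 [:: x; y] => TCat (term_decode x) (term_decode y)
  | GenTree.Node j.+2 [:: x; y] => TInt j (term_decode x) (term_decode y)
  | GenTree.Node _ _ => TOne
  end.

Lemma term_encodeK : cancel term_encode term_decode.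
Proof. by elim=> //= [a -> b ->|j a -> b ->]. Qed.

HB.instance Definition _ := Countable.copy (term Sigma N) (can_type term_encodeK).
End TermCountable.

(** * Words and intercalation *)

Section Words.
Variable Sigma : Type.
Notation word := (seq (sym Sigma)).
Implicit Types (u v w c : word).

Definition is_sep (a : sym Sigma) : bool := if a is Sep then true else false.
Definition wrank (u : word) : nat := count is_sep u.

Lemma wrank_cat u v : wrank (u ++ v) = wrank u + wrank v.
Proof. exact: count_cat. Qed.

Lemma wrank_flatten_nseq p u : wrank u = 0 -> wrank (flatten (nseq p u)) = 0.
Proof. by move=> u0; elim: p => //= p IH; rewrite wrank_cat u0 IH. Qed.

Lemma wrank_sep u : wrank (Sep :: u) = (wrank u).+1.
Proof. by []. Qed.

Lemma wrank_sym a u : wrank (Sym a :: u) = wrank u.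
Proof. by []. Qed.

(** Position 0 and positions beyond the rank fill nothing, so the case distinction is correct for
    every [j]. *)
Lemma intercal_cat j u v c :
  intercal j (u ++ v) c =
  if j <= wrank u then intercal j u c ++ v else u ++ intercal (j - wrank u) v c.
Proof.
elim: u j => [|[|a] u IH] j.
- by case: j => [|j] //=; elim: v => [|[|b] v IHv] //=; rewrite IHv.
- case: j => [|[|j]]; rewrite wrank_sep /= ?catA // IH //=.
  by rewrite ltnS subSS; case: ifP.
- by rewrite wrank_sym /= IH; case: ifP.
Qed.

Lemma intercal_split j u1 u2 c :
  0 < j -> wrank u1 = j.-1 -> intercal j (u1 ++ Sep :: u2) c = u1 ++ c ++ u2.
Proof.
move=> j0 r1; rewrite intercal_cat r1 leqNgt prednK // leqnn /=.
by rewrite (_ : j - j.-1 = 1) //; lia.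
Qed.

Lemma wrank_split j u :
  0 < j <= wrank u -> exists u1 u2, u = u1 ++ Sep :: u2 /\ wrank u1 = j.-1.
Proof.
elim: u j => [|[|a] u IH] j; first by rewrite /wrank /=; lia.
- rewrite wrank_sep; case: j => [|[|j]] // jle; first by exists [::], u.
  have [|u1 [u2 [-> r1]]] := IH j.+1; first lia.
  by exists (Sep :: u1), u2; rewrite wrank_sep r1.
- by rewrite wrank_sym => /IH [u1 [u2 [-> r1]]]; exists (Sym a :: u1), u2.
Qed.

Lemma wrank_intercal j u c :
  0 < j <= wrank u -> wrank (intercal j u c) = (wrank u + wrank c).-1.
Proof.
move=> jP; have [u1 [u2 [-> r1]]] := wrank_split jP.
rewrite intercal_split ?r1 //; last lia.
by rewrite !wrank_cat wrank_sep; lia.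
Qed.

Lemma intercal_catl j u v c :
  j <= wrank u -> intercal j (u ++ v) c = intercal j u c ++ v.
Proof. by move=> h; rewrite intercal_cat h. Qed.

Lemma intercal_catr j u v c :
  wrank u < j -> intercal j (u ++ v) c = u ++ intercal (j - wrank u) v c.
Proof. by move=> h; rewrite intercal_cat leqNgt h. Qed.

(** This law and the next two locate the separator [j] of [intercal i u v] before, inside or after
    the inserted copy of [v]. Here the filling has rank 0, so it removes a separator of [u] and
    shifts the position [i] down by one. *)
Lemma intercal_before i j u v c :
  0 < j < i -> i <= wrank u -> wrank c = 0 ->
  intercal j (intercal i u v) c = intercal i.-1 (intercal j u c) v.
Proof.
move=> ji iu c0; have [|u1 [u2 [-> r1]]] := @wrank_split i u; first lia.
rewrite intercal_split //; last lia.
rewrite intercal_catl; last lia.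
rewrite intercal_catl; last lia.
by rewrite intercal_split // ?wrank_intercal; lia.
Qed.

Lemma intercal_inside i j u v c :
  0 < i <= wrank u -> i <= j < i + wrank v ->
  intercal j (intercal i u v) c = intercal i u (intercal (j - i).+1 v c).
Proof.
move=> iu ij; have [|u1 [u2 [-> r1]]] := @wrank_split i u; first lia.
rewrite !intercal_split //; try lia.
rewrite intercal_catr; last lia.
rewrite intercal_catl; last lia.
by rewrite (_ : j - wrank u1 = (j - i).+1) //; lia.
Qed.

Lemma intercal_after i j u v c :
  0 < i <= wrank u -> i + wrank v <= j ->
  intercal j (intercal i u v) c = intercal i (intercal (j - wrank v).+1 u c) v.
Proof.
move=> iu ij; have [|u1 [u2 [-> r1]]] := @wrank_split i u; first lia.
rewrite [intercal i _ v]intercal_split //; last lia.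
rewrite (@intercal_catr j u1); last lia.
rewrite (@intercal_catr _ v); last lia.
rewrite (@intercal_catr _ u1); last lia.
(* In successor form, the left position visibly skips the [Sep] in front of [u2], and [intercal]
   computes. *)
have -> : (j - wrank v).+1 - wrank u1 = (j - wrank u1 - wrank v).-1.+2 by lia.
have -> : j - wrank u1 - wrank v = (j - wrank u1 - wrank v).-1.+1 by lia.
by rewrite /= intercal_split //; lia.
Qed.

End Words.

(** * Pumping and even contexts *)

Lemma pump_cons (T : Type) (s0 : seq T) q parts p :
  pump s0 (q :: parts) p =
  s0 ++ flatten (nseq p (part_y q)) ++ part_u q ++ flatten (nseq p (part_z q))
     ++ pump (part_s q) parts p.
Proof. by rewrite /pump /= !catA. Qed.

Section Pumpable.
Variable Sigma : Type.
Notation word := (seq (sym Sigma)).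
Notation quad := (word * word * word * word)%type.
Implicit Types (u v : word) (parts : seq quad) (L : word -> Prop).

(** Separators may occur only in the fixed words [part_s]. Hence pumping keeps the rank, and a
    context can fill separators without touching the pumped blocks. *)
Definition sepfree (q : quad) : bool :=
  [&& wrank (part_y q) == 0, wrank (part_u q) == 0 & wrank (part_z q) == 0].
Definition size_yz parts := sumn (map (fun q => size (part_y q) + size (part_z q)) parts).
Definition size_yuz parts :=
  sumn (map (fun q => size (part_y q) + size (part_u q) + size (part_z q)) parts).

(** The conclusion of the theorem, for words with separators and with at most [K] blocks. *)
Definition pumpable K n L v :=
  exists s0 parts,
    [/\ size parts <= K, all sepfree parts & v = pump s0 parts 1] /\
    [/\ 0 < size_yz parts, size_yuz parts <= n & forall p, L (pump s0 parts p)].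

Lemma pumpable_sub K K' n n' L L' v :
  K <= K' -> n <= n' -> (forall u, L u -> L' u) ->
  pumpable K n L v -> pumpable K' n' L' v.
Proof.
move=> KK nn LL [s0 [parts [[a b c] [d e f]]]].
exists s0, parts; split; split => //; [lia|lia|by move=> p; apply: LL].
Qed.

(* A map that acts on a pumped word only through the fixed words [s_i]. *)
Definition pump_context (f : word -> word) :=
  forall s0 parts, all sepfree parts ->
  exists s0' parts', map fst parts' = map fst parts /\
    forall p, f (pump s0 parts p) = pump s0' parts' p.

(** Block count, separator-freeness and both sizes depend only on the triples (y, u, z), that is on
    [map fst parts], which a pump context preserves. *)
Lemma pumpable_context f K n L L' v :
  pump_context f -> (forall u, L u -> L' (f u)) ->
  pumpable K n L v -> pumpable K n L' (f v).
Proof.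
move=> fP LL [s0 [parts [[a b c] [d e g]]]].
have [s0' [parts' [eqp fE]]] := fP s0 parts b.
have tr (h : word * word * word -> nat) :
  map (fun q : quad => h q.1) parts' = map (fun q : quad => h q.1) parts.
  by rewrite !(map_comp h fst) eqp.
have tr2 : all sepfree parts' = all sepfree parts.
  transitivity (all (fun q => [&& wrank q.1.1 == 0, wrank q.1.2 == 0 & wrank q.2 == 0])
                  (map fst parts')); first by rewrite all_map; apply: eq_all.
  by rewrite eqp all_map; apply: eq_all.
exists s0', parts'; split; split.
- by rewrite -(size_map fst) eqp size_map.
- by rewrite tr2.
- by rewrite c fE.
- by rewrite /size_yz (tr (fun x => size x.1.1 + size x.2)).
- by rewrite /size_yuz (tr (fun x => size x.1.1 + size x.1.2 + size x.2)).
- by move=> p; rewrite -fE; apply/LL/g.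
Qed.

Lemma pump_context_catl a : pump_context (cat a).
Proof.
by move=> s0 parts _; exists (a ++ s0), parts; split=> // p; rewrite /pump catA.
Qed.

Lemma pump_context_catr b : pump_context (cat^~ b).
Proof.
move=> s0 parts; elim: parts s0 => [|[x s] parts IH] s0 /=.
  by move=> _; exists (s0 ++ b), [::]; split=> // p; rewrite /pump /= !cats0.
move=> /andP[_ /(IH s) [s' [parts' [e h]]]].
exists s0, ((x, s') :: parts'); rewrite /= e; split=> // p.
by rewrite !pump_cons -!catA /= -h /= -!catA.
Qed.

Lemma pump_context_intercall j a :
  0 < j <= wrank a -> pump_context (intercal j a).
Proof.
move=> jP; have [a1 [a2 [-> r1]]] := wrank_split jP.
move=> s0 parts /(pump_context_catr a2 s0) [s1 [parts1 [e1 h1]]].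
exists (a1 ++ s1), parts1; split=> // p.
rewrite intercal_split ?r1 //; last lia.
by have /= -> := h1 p; rewrite /pump catA.
Qed.

(** Since [y], [u] and [z] have no separator, the [j]-th separator lies in the same fixed word for
    every [p]; the word [b] is inserted there. *)
Lemma pump_context_intercalr j b : pump_context ((intercal j)^~ b).
Proof.
move=> s0 parts; elim: parts s0 j => [|[[[y u] z] s] parts IH] s0 j /=.
  move=> _; exists (intercal j s0 b), [::]; split=> // p.
  by rewrite /pump /= !cats0.
move=> /andP[/and3P[/eqP y0 /eqP u0 /eqP z0] fr].
case: (leqP j (wrank s0)) => js.
  exists (intercal j s0 b), ((y, u, z, s) :: parts); split=> // p.
  by rewrite !pump_cons intercal_catl.
have [s' [parts' [e h]]] := IH s (j - wrank s0) fr.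
exists s0, ((y, u, z, s') :: parts'); rewrite /= e; split=> // p.
rewrite !pump_cons -h /part_y /part_u /part_z /part_s /=.
have yp : wrank (flatten (nseq p y)) = 0 := wrank_flatten_nseq p y0.
have zp : wrank (flatten (nseq p z)) = 0 := wrank_flatten_nseq p z0.
rewrite (@intercal_catr _ _ s0) // (@intercal_catr _ _ (flatten _)) yp; last lia.
have ur : wrank u = 0 := u0.
rewrite (@intercal_catr _ _ u) ur; last lia.
rewrite (@intercal_catr _ _ (flatten _)) zp; last lia.
by rewrite !subn0.
Qed.

Lemma size_yuz_pump s0 parts : size_yuz parts <= size (pump s0 parts 1).
Proof.
elim: parts s0 => // q parts IH s0; rewrite pump_cons.
have E u : flatten (nseq 1 u) = u := cats0 u.
have -> : size_yuz (q :: parts) =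
  size (part_y q) + size (part_u q) + size (part_z q) + size_yuz parts by [].
by rewrite !E 4!size_cat; have := IH (part_s q); lia.
Qed.

Lemma pump_trivial s0 parts p :
  size_yz parts = 0 -> pump s0 parts p = pump s0 parts 0.
Proof.
elim: parts s0 => [|q parts IH] s0 //; rewrite !pump_cons.
have -> : size_yz (q :: parts) = size (part_y q) + size (part_z q) + size_yz parts by [].
move=> h; rewrite IH; last lia.
have -> : part_y q = [::] by apply: size0nil; lia.
have -> : part_z q = [::] by apply: size0nil; lia.
by have -> : flatten (nseq p [::]) = [::] :> word by elim: (p).
Qed.

(** A list that is too short counts as padded with empty pairs, so one [l] acts on words of every
    rank. *)
Fixpoint wrap_seps (l : seq (word * word)) u : word :=
  match u with
  | [::] => [::]
  | Sym a :: u => Sym a :: wrap_seps l u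
  | Sep :: u => (head ([::], [::]) l).1 ++ Sep :: (head ([::], [::]) l).2
                  ++ wrap_seps (behead l) u
  end.

(* The context map [f] keeps every separator of its argument and creates none. *)
Definition even_map (f : word -> word) :=
  exists y0 l zk,
    [/\ wrank y0 = 0, wrank zk = 0,
        forall x, List.In x l -> wrank x.1 = 0 /\ wrank x.2 = 0
      & forall u, f u = y0 ++ wrap_seps l u ++ zk].

(** The list [l] is applied first. The second wrapping acts on the separator itself, so the words of
    [l'] end up next to it and those of [l] outside. *)
Fixpoint wrap_comp (l' l : seq (word * word)) :=
  match l', l with
  | [::], _ => l
  | _, [::] => l'
  | x' :: l', x :: l => (x.1 ++ x'.1, x'.2 ++ x.2) :: wrap_comp l' l
  end.

Lemma wrap_seps_nil u : wrap_seps [::] u = u.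
Proof. by elim: u => [|[|a] u IH] //=; rewrite IH. Qed.

Lemma wrap_seps_catl l u v :
  wrank u = 0 -> wrap_seps l (u ++ v) = u ++ wrap_seps l v.
Proof. by elim: u => [|[|a] u IH] //= u0; rewrite IH. Qed.

Lemma wrap_seps_catr l u v :
  wrank v = 0 -> wrap_seps l (u ++ v) = wrap_seps l u ++ v.
Proof.
move=> v0; elim: u l => [|[|a] u IH] l //=; last by rewrite IH.
  by rewrite -[v in LHS]cats0 wrap_seps_catl //= cats0.
by rewrite IH -!catA /= -!catA.
Qed.

Lemma In_head T (P : T -> Prop) d l :
  P d -> (forall x, List.In x l -> P x) -> P (head d l).
Proof. by case: l => //= a l Pd h; apply: h; left. Qed.

Lemma In_behead T (P : T -> Prop) l :
  (forall x, List.In x l -> P x) -> forall x, List.In x (behead l) -> P x.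
Proof. by case: l => //= a l h x xl; apply: h; right. Qed.

Lemma head_wrap_comp l' l :
  head ([::], [::]) (wrap_comp l' l) =
  ((head ([::], [::]) l).1 ++ (head ([::], [::]) l').1,
   (head ([::], [::]) l').2 ++ (head ([::], [::]) l).2).
Proof. by case: l' l => [|[a b] l'] [|[c d] l] //=; rewrite ?cats0. Qed.

Lemma behead_wrap_comp l' l :
  behead (wrap_comp l' l) = wrap_comp (behead l') (behead l).
Proof. by case: l' l => [|[a b] l'] [|[c d] l] //=; case: l'. Qed.

Lemma wrap_seps_comp l' l u :
  (forall x, List.In x l -> wrank x.1 = 0 /\ wrank x.2 = 0) ->
  wrap_seps l' (wrap_seps l u) = wrap_seps (wrap_comp l' l) u.
Proof.
elim: u l l' => [|[|a] u IH] l l' hl //=; last by rewrite IH.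
have [|h1 h2] := In_head (d := ([::], [::])) _ hl; first by [].
rewrite wrap_seps_catl //= head_wrap_comp behead_wrap_comp /=.
by rewrite wrap_seps_catl // IH -?catA //; apply: In_behead.
Qed.

Lemma In_wrap_comp l' l :
  (forall x, List.In x l -> wrank x.1 = 0 /\ wrank x.2 = 0) ->
  (forall x, List.In x l' -> wrank x.1 = 0 /\ wrank x.2 = 0) ->
  forall x, List.In x (wrap_comp l' l) -> wrank x.1 = 0 /\ wrank x.2 = 0.
Proof.
elim: l' l => [|x' l' IH] [|x l] //= h h' y [<-|yl] /=.
  have [a b] := h _ (or_introl erefl); have [c d] := h' _ (or_introl erefl).
  by rewrite !wrank_cat; lia.
by apply: (IH l) yl => z zl; [apply: h|apply: h']; right.
Qed.

Lemma even_map_comp f g : even_map f -> even_map g -> even_map (g \o f).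
Proof.
move=> [y [l [z [y0 z0 h fE]]]] [y' [l' [z' [y0' z0' h' gE]]]].
exists (y' ++ y), (wrap_comp l' l), (z ++ z'); split.
- by rewrite wrank_cat y0 y0'.
- by rewrite wrank_cat z0 z0'.
- exact: In_wrap_comp.
- by move=> u; rewrite /= fE gE wrap_seps_catl // wrap_seps_catr // wrap_seps_comp // -!catA.
Qed.

Lemma even_map_id : even_map id.
Proof. by exists [::], [::], [::]; split=> // u; rewrite wrap_seps_nil cats0. Qed.

Lemma even_map_catl a : wrank a = 0 -> even_map (cat a).
Proof. by move=> a0; exists a, [::], [::]; split=> // u; rewrite wrap_seps_nil cats0. Qed.

Lemma even_map_catr b : wrank b = 0 -> even_map (cat^~ b).
Proof. by move=> b0; exists [::], [::], b; split=> // u; rewrite wrap_seps_nil. Qed.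

(** The argument takes the place of the only separator of [a], hence is merely enclosed by two words
    of rank 0. *)
Lemma even_map_intercall j a : 0 < j -> j <= wrank a -> wrank a = 1 -> even_map (intercal j a).
Proof.
move=> j0 ja a1; have [|b [c [aE b0]]] := @wrank_split _ j a; first lia.
have bc : wrank b + (wrank c).+1 = 1 by move: a1; rewrite aE wrank_cat wrank_sep.
exists b, [::], c; split=> //; try lia.
by move=> u; rewrite aE intercal_split // wrap_seps_nil.
Qed.

Lemma even_map_intercalr j b : 0 < j -> wrank b = 1 -> even_map ((intercal j)^~ b).
Proof.
move=> j0 b1; have [|c [d [bE c0]]] := @wrank_split _ 1 b; first lia.
have cd : wrank c + (wrank d).+1 = 1 by move: b1; rewrite bE wrank_cat wrank_sep.
(* Replacing the [j]-th separator by [b = c ++ Sep :: d] wraps it in [(c, d)]; the [j.-1] separators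
   before it get empty pairs. *)
exists [::], (rcons (nseq j.-1 ([::], [::])) (c, d)), [::]; split=> //.
  elim: (j.-1) => [|i IH] x /=; last by case=> [<-//|/IH].
  by case=> // <- /=; lia.
move=> u; rewrite cats0 /=.
elim: u j j0 => [|[|a] u IH] [|j] //= _; last by rewrite IH.
case: j => [|j] /=; first by rewrite wrap_seps_nil bE -catA.
by rewrite IH.
Qed.

(** * Iterates of an even map as pumped words *)

Fixpoint even_parts y (l : seq (word * word)) zk u (us : seq word) : seq quad :=
  match us with
  | [::] => [:: (y, u, zk, [::])]
  | u' :: us => (y, u, (head ([::], [::]) l).1, [:: Sep]) ::
      even_parts (head ([::], [::]) l).2 (behead l) zk u' us
  end.

Definition join_seps u us : word := u ++ flatten (map (cons Sep) us).

Lemma join_sepsP u :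
  exists v vs, [/\ u = join_seps v vs, size vs = wrank u & all (fun v => wrank v == 0) (v :: vs)].
Proof.
elim: u => [|[|a] u [v [vs [-> e h]]]]; first by exists [::], [::].
  by exists [::], (v :: vs); rewrite /= e; split.
by exists (Sym a :: v), vs; split.
Qed.

Definition word_pow p u : word := flatten (nseq p u).

Lemma word_powSr p u : word_pow p.+1 u = word_pow p u ++ u.
Proof. by rewrite /word_pow; elim: p => [|p IH]; rewrite /= ?cats0 // -catA -IH. Qed.

Lemma pump_even_parts y l zk u us p :
  all (fun v => wrank v == 0) (u :: us) ->
  pump [::] (even_parts y l zk u us) p =
  word_pow p y ++
  wrap_seps (map (fun x => (word_pow p x.1, word_pow p x.2)) l) (join_seps u us) ++
  word_pow p zk.
Proof.
elim: us u y l => [|u' us IH] u y l /= /andP[/eqP u0 h].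
  by rewrite pump_cons /pump /= !cats0 /join_seps /= wrap_seps_catl // cats0.
rewrite pump_cons wrap_seps_catl //=.
have hE : head ([::], [::]) [seq (word_pow p x.1, word_pow p x.2) | x <- l] =
   (word_pow p (head ([::], [::]) l).1, word_pow p (head ([::], [::]) l).2).
  case: l => //=; suff -> : word_pow p [::] = [::] by []. by rewrite /word_pow; elim: (p).
have := IH u' (head ([::], [::]) l).2 (behead l) h.
by rewrite hE /pump /= behead_map -!catA /= => ->; rewrite -!catA.
Qed.

(** Each iteration adds its words on the same sides of the same blocks, so powers accumulate.
    Together with [pump_even_parts] this identifies the [p]-th pump of [f] at [x] with
    [iter p f x]. *)
Lemma iter_even_map f y l zk :
  wrank y = 0 -> wrank zk = 0 ->
  (forall x, List.In x l -> wrank x.1 = 0 /\ wrank x.2 = 0) ->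
  (forall u, f u = y ++ wrap_seps l u ++ zk) ->
  forall p u, iter p f u =
    word_pow p y ++ wrap_seps (map (fun x => (word_pow p x.1, word_pow p x.2)) l) u
    ++ word_pow p zk.
Proof.
move=> y0 z0 h fE; elim=> [|p IH] u.
  rewrite /word_pow /= cats0; elim: u l {h fE} => [|[|a] u IH] l //=.
    by rewrite behead_map -IH; case: (l).
  by rewrite -IH.
rewrite iterS IH fE wrap_seps_catl ?wrank_flatten_nseq //.
rewrite wrap_seps_catr ?wrank_flatten_nseq //.
have h' : forall x, List.In x [seq (word_pow p x.1, word_pow p x.2) | x <- l] ->
   wrank x.1 = 0 /\ wrank x.2 = 0.
  elim: l h {fE IH} => //= x l IHl h z [<- /=|]; last by apply: IHl => t ?; apply: h; right.
  by have [a b] := h _ (or_introl erefl); rewrite !wrank_flatten_nseq.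
rewrite wrap_seps_comp // [word_pow p.+1 zk]word_powSr -!catA;
  congr (_ ++ (_ ++ (wrap_seps _ _ ++ _))).
by elim: l {h fE h' IH} => //= x l ->; rewrite word_powSr.
Qed.

(** Cutting [x] at its separators gives [(wrank x).+1] blocks. If all the words around them are
    empty, then the pumps for [p = 1] and [p = 0] agree, that is [f x = x], and the repetition can
    be shortcut. *)
Lemma pumpable_even_map K n L f x :
  even_map f -> wrank x < K -> size (f x) <= n ->
  L x -> (forall u, L u -> L (f u)) -> f x = x \/ pumpable K n L (f x).
Proof.
move=> [y [l [z [y0 z0 h fE]]]] xK fn Lx Lf.
have [v [vs [xE svs hv]]] := join_sepsP x.
have pE p : pump [::] (even_parts y l z v vs) p = iter p f x.
  by rewrite pump_even_parts // (iter_even_map y0 z0 h fE) xE.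
case: (posnP (size_yz (even_parts y l z v vs))) => yz.
  by left; have := pump_trivial [::] 1 yz; rewrite !pE.
right; exists [::], (even_parts y l z v vs); split; split=> //.
- suff -> : size (even_parts y l z v vs) = (size vs).+1 by rewrite svs.
  by clear; elim: vs y l v => //= v' vs IH y l v; rewrite IH.
- clear -y0 z0 h hv; elim: vs y l v y0 h hv => [|v' vs IH] y l v y0 h /= /andP[v0 hv].
    by rewrite /sepfree /part_y /part_u /part_z /= y0 z0 v0.
  have [|h1 h2] := In_head (d := ([::], [::])) _ h; first by [].
  rewrite {1}/sepfree /part_y /part_u /part_z /= y0 h1 v0 /=.
  by apply: IH => //; apply: In_behead.
- by apply: leq_trans fn; have := size_yuz_pump [::] (even_parts y l z v vs); rewrite pE.
- by move=> p; rewrite pE; elim: p => //= p; apply: Lf.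
Qed.

End Pumpable.

(** * Grammars *)

Section Grammars.
Variable Sigma : finType.
Notation word := (seq (sym Sigma)).

Fixpoint den (N : Type) (rho : N -> word -> Prop) (t : term Sigma N) (v : word) : Prop :=
  match t with
  | TN A => rho A v
  | TW w => v = map (@Sym Sigma) w
  | TOne => v = [:: Sep]
  | TCat a b => exists u1 u2, [/\ den rho a u1, den rho b u2 & v = u1 ++ u2]
  | TInt j a b => exists u1 u2, [/\ den rho a u1, den rho b u2 & v = intercal j u1 u2]
  end.

(** The stages of the least fixed point of the rules: [m] bounds the height of a derivation tree,
    which makes induction on height available. *)
Fixpoint lang_upto (N : finType) (T : N -> seq (term Sigma N))
    (m : nat) (A : N) (v : word) : Prop :=
  if m is m.+1 then exists2 t, t \in T A & den (lang_upto T m) t v else False.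

Definition lang_of (N : finType) (T : N -> seq (term Sigma N)) (A : N) (v : word) : Prop :=
  exists m, lang_upto T m A v.

(* All subterms have rank less than [K]; nonterminals have rank less than [h]. *)
Fixpoint ok (N : Type) (rk : N -> nat) (h K : nat) (t : term Sigma N) : bool :=
  match t with
  | TN A => (rk A < h) && (rk A < K)
  | TW _ => 0 < K
  | TOne => 1 < K
  | TCat a b => [&& ok rk h K a, ok rk h K b & rank rk a + rank rk b < K]
  | TInt j a b =>
      [&& ok rk h K a, ok rk h K b, 0 < j <= rank rk a & rank rk a + rank rk b <= K]
  end.

Definition wf (N : finType) (rk : N -> nat) (K : nat) (T : N -> seq (term Sigma N)) :=
  forall A t, t \in T A -> rank rk t = rk A /\ ok rk K K t.

Lemma den_mono (N : Type) (rho rho' : N -> word -> Prop) t v :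
  (forall A u, rho A u -> rho' A u) -> den rho t v -> den rho' t v.
Proof.
move=> h; elim: t v => //= [a IHa b IHb v|j a IHa b IHb v].
  by case=> u1 [u2 [/IHa d1 /IHb d2 ->]]; exists u1, u2.
by case=> u1 [u2 [/IHa d1 /IHb d2 ->]]; exists u1, u2.
Qed.

Lemma lang_upto_mono (N : finType) (T : N -> seq (term Sigma N)) m m' A v :
  m <= m' -> lang_upto T m A v -> lang_upto T m' A v.
Proof.
elim: m m' A v => [|m IH] [|m'] A v //= mm [t tA d]; exists t => //.
by apply: den_mono d => B u; apply: IH.
Qed.

(* A term has finitely many leaves, so finitely many derivation heights occur. *)
Lemma den_lang_of (N : finType) (T : N -> seq (term Sigma N)) t v :
  den (lang_of T) t v -> exists m, den (lang_upto T m) t v.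
Proof.
have up m m' t' v' : m <= m' -> den (lang_upto T m) t' v' -> den (lang_upto T m') t' v'.
  by move=> mm; apply: den_mono => A u; apply: lang_upto_mono.
elim: t v => [A|w|//|a IHa b IHb|j a IHa b IHb] v //=; try by exists 0.
- case=> u1 [u2 [/IHa [m1 d1] /IHb [m2 d2] ->]]; exists (maxn m1 m2), u1, u2; split=> //.
    by apply: up d1; rewrite leq_maxl.
  by apply: up d2; rewrite leq_maxr.
- case=> u1 [u2 [/IHa [m1 d1] /IHb [m2 d2] ->]]; exists (maxn m1 m2), u1, u2; split=> //.
    by apply: up d1; rewrite leq_maxl.
  by apply: up d2; rewrite leq_maxr.
Qed.

Lemma lang_ofI (N : finType) (T : N -> seq (term Sigma N)) A t v :
  t \in T A -> den (lang_of T) t v -> lang_of T A v.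
Proof. by move=> tA /den_lang_of [m d]; exists m.+1, t. Qed.

Lemma ok_rank (N : Type) (rk : N -> nat) h K t : ok rk h K t -> rank rk t < K.
Proof. by case: t => //= [A /andP[]|a b /and3P[]|j a b /and4P[_ _ ? ?]] //; lia. Qed.

Lemma den_rank (N : Type) (rk : N -> nat) h K (rho : N -> word -> Prop) t v :
  (forall A u, rho A u -> wrank u = rk A) ->
  ok rk h K t -> den rho t v -> wrank v = rank rk t.
Proof.
move=> hr; elim: t v => [A|w|//|a IHa b IHb|j a IHa b IHb] v /=; first by move=> _ /hr.
- by move=> _ ->; elim: w.
- by move=> _ ->.
- by case/and3P=> oa ob _ [u1 [u2 [/IHa r1 /IHb r2 ->]]]; rewrite wrank_cat r1 ?r2.
- case/and4P=> oa ob jP _ [u1 [u2 [/IHa r1 /IHb r2 ->]]].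
  by rewrite wrank_intercal r1 ?r2.
Qed.

Lemma lang_upto_rank (N : finType) (rk : N -> nat) K T m A v :
  wf rk K T -> lang_upto T m A v -> wrank v = rk A.
Proof.
move=> wfT; elim: m A v => //= m IH A v [t tA d].
by have [<- okt] := wfT _ _ tA; apply: den_rank okt d.
Qed.

Lemma lang_of_rank (N : finType) (rk : N -> nat) K T A v :
  wf rk K T -> lang_of T A v -> wrank v = rk A.
Proof. by move=> wfT [m]; apply: lang_upto_rank wfT. Qed.

(** * Flat grammars, whose rules contain at most one operation *)

Section Flattening.
Variables (N : finType) (rk : N -> nat) (K : nat) (T : N -> seq (term Sigma N)).

Fixpoint subterms (t : term Sigma N) : seq (term Sigma N) :=
  t :: match t with
       | TCat a b | TInt _ a b => subterms a ++ subterms b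
       | _ => [::]
       end.

Definition flat_states : seq (term Sigma N) :=
  [seq TN A | A <- enum N] ++ flatten [seq flatten (map subterms (T A)) | A <- enum N].

Definition flat_nonterm := seq_sub flat_states.

Lemma flat_nontermP A : TN A \in flat_states.
Proof. by rewrite mem_cat map_f ?mem_enum. Qed.

Definition flat_embed A : flat_nonterm := SeqSub (flat_nontermP A).

Definition flat_rank (x : flat_nonterm) : nat := rank rk (val x).

(** Each subterm of a rule becomes a nonterminal that generates its own top node. The [x] in
    [insubd x a] is a default value which is never taken, because [flat_states] is closed under
    subterms. *)
Definition flat_rules (x : flat_nonterm) : seq (term Sigma flat_nonterm) :=
  match val x with
  | TN A => [seq TN (insubd x t) | t <- T A]
  | TW w => [:: TW w]
  | TOne => [:: TOne]
  | TCat a b => [:: TCat (TN (insubd x a)) (TN (insubd x b))]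
  | TInt j a b => [:: TInt j (TN (insubd x a)) (TN (insubd x b))]
  end.

Lemma subterms_refl t : t \in subterms t.
Proof. by case: t => * /=; rewrite in_cons eqxx. Qed.

Lemma subterms_trans s t : s \in subterms t -> {subset subterms s <= subterms t}.
Proof.
elim: t => [A|w||a IHa b IHb|j a IHa b IHb] /=; rewrite in_cons => /orP[/eqP->//|] //=.
- rewrite mem_cat => /orP[/IHa|/IHb] h x /h xs;
  by rewrite in_cons mem_cat xs ?orbT.
- rewrite mem_cat => /orP[/IHa|/IHb] h x /h xs;
  by rewrite in_cons mem_cat xs ?orbT.
Qed.

Lemma flat_statesP s :
  reflect ((exists A, s = TN A) \/ (exists A t, t \in T A /\ s \in subterms t))
    (s \in flat_states).
Proof.
rewrite mem_cat; apply: (iffP orP).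
- case=> [/mapP [A _ ->]|/flattenP [l /mapP [A _ ->]]]; first by left; exists A.
  by case/flattenP=> l' /mapP [t tA ->] st; right; exists A, t.
- case=> [[A ->]|[A [t [tA st]]]]; first by left; rewrite map_f ?mem_enum.
  right; apply/flattenP; exists (flatten (map subterms (T A))).
    by rewrite (map_f (fun A => _)) ?mem_enum.
  by apply/flattenP; exists (subterms t); rewrite ?map_f.
Qed.

Lemma flat_states_sub s t : t \in flat_states -> s \in subterms t -> s \in flat_states.
Proof.
move=> /flat_statesP [[A ->] /=|[A [r [rA tr]]] st].
  by rewrite mem_seq1 => /eqP ->; apply: flat_nontermP.
by apply/flat_statesP; right; exists A, r; split=> //; apply: subterms_trans st.
Qed.

Lemma flat_states_rule A t : t \in T A -> t \in flat_states.
Proof. by move=> tA; apply/flat_statesP; right; exists A, t; split=> //; apply: subterms_refl. Qed.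

Lemma flat_states_cat a b :
  TCat a b \in flat_states -> a \in flat_states /\ b \in flat_states.
Proof.
by move=> h; split; apply: (flat_states_sub h); rewrite /= in_cons mem_cat subterms_refl ?orbT.
Qed.

Lemma flat_states_int j a b :
  TInt j a b \in flat_states -> a \in flat_states /\ b \in flat_states.
Proof.
by move=> h; split; apply: (flat_states_sub h); rewrite /= in_cons mem_cat subterms_refl ?orbT.
Qed.

Lemma ok_subterms s t : ok rk K K t -> s \in subterms t -> ok rk K K s.
Proof.
elim: t => [A|w||a IHa b IHb|j a IHa b IHb]; rewrite [subterms _]/= in_cons;
  move=> o /orP[/eqP->//|] //=; rewrite mem_cat.
- by case/and3P: o => /IHa ha /IHb hb _ /orP[/ha|/hb].
- by case/and4P: o => /IHa ha /IHb hb _ _ /orP[/ha|/hb].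
Qed.

Lemma flat_rules_wf : wf rk K T -> wf flat_rank K flat_rules.
Proof.
move=> wfT [s sS] t; rewrite /flat_rules /flat_rank /=.
have rE x r : r \in flat_states -> rank rk (val (insubd x r : flat_nonterm)) = rank rk r.
  by move=> rS; rewrite insubdK.
have [[A sE]|[A [r [rA sr]]]] := flat_statesP _ sS.
  subst s => /mapP [r rA ->] /=; have [rr okr] := wfT _ _ rA.
  rewrite /flat_rank rE ?rr //; last exact: flat_states_rule rA.
  by rewrite -rr (ok_rank okr).
have oks : ok rk K K s by apply: ok_subterms sr; have [] := wfT _ _ rA.
case: s sS oks sr => [B|w||a b|j a b] sS oks _ /=.
- case/mapP=> r' r'B -> /=; have [rr okr] := wfT _ _ r'B.
  rewrite /flat_rank rE ?rr //; exact: flat_states_rule r'B.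
- by rewrite mem_seq1 => /eqP ->.
- by rewrite mem_seq1 => /eqP ->.
- rewrite mem_seq1 => /eqP -> /=; have [aS bS] := flat_states_cat sS.
  rewrite /flat_rank !rE //; case/and3P: oks => /ok_rank ra /ok_rank rb rab.
  by rewrite ra rb rab.
- rewrite mem_seq1 => /eqP -> /=; have [aS bS] := flat_states_int sS.
  rewrite /flat_rank !rE //; case/and4P: oks => /ok_rank ra /ok_rank rb jP rab.
  by rewrite ra rb jP rab.
Qed.

Lemma flat_lang_sound m x v : lang_upto flat_rules m x v -> den (lang_of T) (val x) v.
Proof.
elim: m x v => //= m IH [s sS] v [t]; rewrite /flat_rules /=.
case: s sS => [B|w||a b|j a b] sS /=.
- case/mapP=> r rB -> /= /IH; rewrite insubdK ?(flat_states_rule rB) //.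
  exact: lang_ofI.
- by rewrite mem_seq1 => /eqP ->.
- by rewrite mem_seq1 => /eqP ->.
- have [aS bS] := flat_states_cat sS.
  rewrite mem_seq1 => /eqP -> /= [u1 [u2 [/IH d1 /IH d2 ->]]].
  by exists u1, u2; move: d1 d2; rewrite !insubdK.
- have [aS bS] := flat_states_int sS.
  rewrite mem_seq1 => /eqP -> /= [u1 [u2 [/IH d1 /IH d2 ->]]].
  by exists u1, u2; move: d1 d2; rewrite !insubdK.
Qed.

(** The induction on the structure of a right-hand side is separated from the induction on height:
    the hypothesis on [rho] supplies the original nonterminals at smaller height. *)
Lemma flat_den_complete (rho : N -> word -> Prop) :
  (forall A v (AS : TN A \in flat_states), rho A v -> lang_of flat_rules (SeqSub AS) v) ->
  forall s (sS : s \in flat_states) v, den rho s v -> lang_of flat_rules (SeqSub sS) v.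
Proof.
move=> hrho; elim=> [A|w||a IHa b IHb|j a IHa b IHb] sS v.
- exact: hrho.
- by move=> /= ->; apply: (lang_ofI (t := TW w)) => //; rewrite mem_seq1.
- by move=> /= ->; apply: (lang_ofI (t := TOne)) => //; rewrite mem_seq1.
- have [aS bS] := flat_states_cat sS.
  case=> u1 [u2 [/(IHa aS) d1 /(IHb bS) d2 ->]].
  apply: lang_ofI; first exact: mem_head.
  exists u1, u2; split=> //=.
    by have -> : insubd (SeqSub sS) a = SeqSub aS by apply: val_inj; rewrite insubdK.
  by have -> : insubd (SeqSub sS) b = SeqSub bS by apply: val_inj; rewrite insubdK.
- have [aS bS] := flat_states_int sS.
  case=> u1 [u2 [/(IHa aS) d1 /(IHb bS) d2 ->]].
  apply: lang_ofI; first exact: mem_head.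
  exists u1, u2; split=> //=.
    by have -> : insubd (SeqSub sS) a = SeqSub aS by apply: val_inj; rewrite insubdK.
  by have -> : insubd (SeqSub sS) b = SeqSub bS by apply: val_inj; rewrite insubdK.
Qed.

Lemma flat_lang_complete m A v (AS : TN A \in flat_states) :
  lang_upto T m A v -> lang_of flat_rules (SeqSub AS) v.
Proof.
elim: m A v AS => // m IHm A v AS [t tA d]; have tS := flat_states_rule tA.
apply: (lang_ofI (t := TN (insubd (SeqSub AS) t))); first by rewrite /flat_rules /= map_f.
have -> : insubd (SeqSub AS) t = SeqSub tS by apply: val_inj; rewrite insubdK.
exact: flat_den_complete d.
Qed.

Lemma flat_embedP A v : lang_of flat_rules (flat_embed A) v <-> lang_of T A v.
Proof.
split=> [[m /flat_lang_sound]//|[m d]].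
exact: flat_lang_complete d.
Qed.

End Flattening.

Definition flat (N : Type) (t : term Sigma N) : bool :=
  match t with
  | TN _ | TW _ | TOne | TCat (TN _) (TN _) | TInt _ (TN _) (TN _) => true
  | _ => false
  end.

Lemma flat_rules_flat (N : finType) (T : N -> seq (term Sigma N)) x t :
  t \in flat_rules x -> flat (t : term Sigma (flat_nonterm T)).
Proof.
case: x => [s sS]; rewrite /flat_rules /=.
by case: s sS => [A|w||a b|j a b] sS /=; [case/mapP=> r _ ->|..] => //; rewrite mem_seq1 => /eqP->.
Qed.

(** * Eliminating rank [k] *)

Section Lowering.
Variables (N : Type) (rk : N -> nat) (k : nat).
Implicit Types (t a b c : term Sigma N).

(* With argument [Some (j, c)], the term [c] of rank 0 is intercalated at
   position [j] while being pushed down to the leaves; this makes the nodes of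
   rank [k] of [t] disappear. *)
Fixpoint norm (o : option (nat * term Sigma N)) (t : term Sigma N) : term Sigma N :=
  match t, o with
  | (TN _ | TW _ | TOne), None => t
  | TOne, Some (_, c) => c
  | (TN _ | TW _), Some (j, c) => TInt j t c
  | TCat a b, None => TCat (norm None a) (norm None b)
  | TCat a b, Some (j, c) =>
      if j <= rank rk a then TCat (norm (Some (j, c)) a) (norm None b)
      else TCat (norm None a) (norm (Some (j - rank rk a, c)) b)
  | TInt i a b, None =>
      if rank rk a == k then norm (Some (i, norm None b)) a
      else TInt i (norm None a) (norm None b)
  | TInt i a b, Some (j, c) =>
      if j < i then TInt i.-1 (norm (Some (j, c)) a) (norm None b)
      else if j < i + rank rk b then
        if rank rk a == k then norm (Some (i, norm (Some ((j - i).+1, c)) b)) a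
        else TInt i (norm None a) (norm (Some ((j - i).+1, c)) b)
      else TInt i (norm (Some ((j - rank rk b).+1, c)) a) (norm None b)
  end.

Variable rho : N -> word -> Prop.
Hypothesis rho_rank : forall A u, rho A u -> wrank u = rk A.

Definition den_eq t t' := forall v, den rho t v <-> den rho t' v.

Lemma den_eq_trans t1 t2 t3 : den_eq t1 t2 -> den_eq t2 t3 -> den_eq t1 t3.
Proof. by move=> h h' v; split=> [/h /h'|/h' /h]. Qed.

Lemma den_eq_cat a a' b b' : den_eq a a' -> den_eq b b' -> den_eq (TCat a b) (TCat a' b').
Proof.
by move=> ea eb v; split=> -[u1 [u2 [/ea d1 /eb d2 ->]]]; exists u1, u2.
Qed.

Lemma den_eq_int j a a' b b' :
  den_eq a a' -> den_eq b b' -> den_eq (TInt j a b) (TInt j a' b').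
Proof.
by move=> ea eb v; split=> -[u1 [u2 [/ea d1 /eb d2 ->]]]; exists u1, u2.
Qed.

Section Laws.
Variables (h K j i : nat) (a b c : term Sigma N).
Hypotheses (oka : ok rk h K a) (okb : ok rk h K b) (okc : ok rk h K c).
Let wra u := @den_rank _ _ _ _ _ _ u rho_rank oka.
Let wrb u := @den_rank _ _ _ _ _ _ u rho_rank okb.
Let wrc u := @den_rank _ _ _ _ _ _ u rho_rank okc.

(** The five laws of this section carry the identities on words over to terms; by [den_rank], the
    rank of a subterm tells where a position falls. *)
Lemma den_eq_catl : j <= rank rk a -> den_eq (TCat (TInt j a c) b) (TInt j (TCat a b) c).
Proof.
move=> jP v; split=> /=.
- case=> _ [ub [[ua [uc [da dc ->]]] db ->]]; exists (ua ++ ub), uc.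
  by split=> //; [exists ua, ub|rewrite intercal_catl ?(wra da)].
- case=> _ [uc [[ua [ub [da db ->]]] dc ->]]; exists (intercal j ua uc), ub.
  by split=> //; [exists ua, uc|rewrite intercal_catl ?(wra da)].
Qed.

Lemma den_eq_catr :
  rank rk a < j -> den_eq (TCat a (TInt (j - rank rk a) b c)) (TInt j (TCat a b) c).
Proof.
move=> jP v; split=> /=.
- case=> ua [_ [da [ub [uc [db dc ->]]] ->]]; exists (ua ++ ub), uc.
  by split=> //; [exists ua, ub|rewrite intercal_catr ?(wra da)].
- case=> _ [uc [[ua [ub [da db ->]]] dc ->]]; exists ua, (intercal (j - rank rk a) ub uc).
  by split=> //; [exists ub, uc|rewrite intercal_catr ?(wra da)].
Qed.

Lemma den_eq_before : 0 < j < i -> i <= rank rk a -> rank rk c = 0 ->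
  den_eq (TInt i.-1 (TInt j a c) b) (TInt j (TInt i a b) c).
Proof.
move=> jP iP c0 v; split=> /=.
- case=> _ [ub [[ua [uc [da dc ->]]] db ->]]; exists (intercal i ua ub), uc.
  by split=> //; [exists ua, ub|rewrite [RHS]intercal_before ?(wra da) ?(wrc dc)].
- case=> _ [uc [[ua [ub [da db ->]]] dc ->]]; exists (intercal j ua uc), ub.
  by split=> //; [exists ua, uc|rewrite [LHS]intercal_before ?(wra da) ?(wrc dc)].
Qed.

Lemma den_eq_inside : 0 < i <= rank rk a -> i <= j < i + rank rk b ->
  den_eq (TInt i a (TInt (j - i).+1 b c)) (TInt j (TInt i a b) c).
Proof.
move=> iP jP v; split=> /=.
- case=> ua [_ [da [ub [uc [db dc ->]]] ->]]; exists (intercal i ua ub), uc.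
  by split=> //; [exists ua, ub|rewrite [RHS]intercal_inside ?(wra da) ?(wrb db)].
- case=> _ [uc [[ua [ub [da db ->]]] dc ->]]; exists ua, (intercal (j - i).+1 ub uc).
  by split=> //; [exists ub, uc|rewrite [LHS]intercal_inside ?(wra da) ?(wrb db)].
Qed.

Lemma den_eq_after : 0 < i <= rank rk a -> i + rank rk b <= j ->
  den_eq (TInt i (TInt (j - rank rk b).+1 a c) b) (TInt j (TInt i a b) c).
Proof.
move=> iP jP v; split=> /=.
- case=> _ [ub [[ua [uc [da dc ->]]] db ->]]; exists (intercal i ua ub), uc.
  by split=> //; [exists ua, ub|rewrite [RHS]intercal_after ?(wra da) ?(wrb db)].
- case=> _ [uc [[ua [ub [da db ->]]] dc ->]]; exists (intercal (j - rank rk b).+1 ua uc), ub.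
  by split=> //; [exists ua, uc|rewrite [LHS]intercal_after ?(wra da) ?(wrb db)].
Qed.

End Laws.

Lemma ok_weaken h h' K K' t : h <= h' -> K <= K' -> ok rk h K t -> ok rk h' K' t.
Proof.
by move=> hh KK; elim: t => [A|w||a IHa b IHb|j a IHa b IHb] /=; lia.
Qed.

(** Both halves need each other: a node of rank [k] below a node of smaller rank is left by a
    filling of rank 0, and pushing this filling down lowers by one the rank of every node that it
    passes. *)
Lemma norm_spec t : ok rk k k.+1 t ->
  (rank rk t < k ->
     [/\ ok rk k k (norm None t), rank rk (norm None t) = rank rk t & den_eq (norm None t) t]) /\
  (forall j c, ok rk k k c -> rank rk c = 0 -> 0 < j <= rank rk t ->
     [/\ ok rk k k (norm (Some (j, c)) t), rank rk (norm (Some (j, c)) t) = (rank rk t).-1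
       & den_eq (norm (Some (j, c)) t) (TInt j t c)]).
Proof.
elim: t => [A|w||a IHa b IHb|i a IHa b IHb].
- rewrite /= => /andP[Ak _]; split=> [_|j c okc c0 jP]; first by rewrite Ak.
  by rewrite c0 addn0 Ak okc jP ltnW //; split.
- by move=> _; split=> [|j c okc c0] /=; [split|lia].
- move=> _; split=> [/= k1|j c okc c0 jP] /=; first by split=> //; lia.
  have j1 : j = 1 by move: jP => /=; lia.
  split=> // v; split=> [dc|[_ [uc [-> dc ->]]]]; last by rewrite j1 /= cats0.
  by exists [:: Sep], v; split=> //; rewrite j1 /= cats0.
- case/and3P=> oka okb rab; have [IHa1 IHa2] := IHa oka; have [IHb1 IHb2] := IHb okb.
  split=> [/= rk1|j c okc c0 /= jP].
    have [o1 r1 e1] := IHa1 ltac:(lia); have [o2 r2 e2] : _ := IHb1 ltac:(lia).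
    by rewrite o1 o2 r1 r2; split=> //; apply: den_eq_cat.
  case: (leqP j (rank rk a)) => ja /=.
    have [o1 r1 e1] := IHa2 j c okc c0 ltac:(lia).
    have [o2 r2 e2] := IHb1 ltac:(lia).
    rewrite o1 o2 r1 r2; split; [lia|lia|].
    apply: den_eq_trans (den_eq_catl _ _ oka ja); exact: den_eq_cat.
  have [o1 r1 e1] := IHb2 (j - rank rk a) c okc c0 ltac:(lia).
  have [o2 r2 e2] := IHa1 ltac:(lia).
  rewrite o1 o2 r1 r2; split; [lia|lia|].
  apply: den_eq_trans (den_eq_catr _ _ oka ja); exact: den_eq_cat.
- case/and4P=> oka okb iP rab; have [IHa1 IHa2] := IHa oka; have [IHb1 IHb2] := IHb okb.
  have rka := ok_rank oka; have rkb := ok_rank okb.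
  split=> [/= rk1|j c okc c0 /= jP].
    have [o2 r2 e2] := IHb1 ltac:(lia).
    (* If [a] has rank [k], the rank of the whole forces [b] to have rank 0, so [norm None b] can be
       pushed into [a]. *)
    case: eqP => rak /=.
      have [o1 r1 e1] := IHa2 i (norm None b) o2 ltac:(lia) iP.
      split=> //; first by lia.
      by apply: den_eq_trans e1 _; apply: den_eq_int.
    have [o1 r1 e1] := IHa1 ltac:(lia).
    rewrite o1 o2 r1 r2; split; [lia|lia|exact: den_eq_int].
  have okc' : ok rk k k.+1 c by apply: ok_weaken okc.
  (* Before or after the copy of [b], the filled separator belongs to [a] and differs from the
     [i]-th one. Then [a] has rank at least 2, so [b] has rank less than [k]. *)
  case: (ltnP j i) => ji /=.
    have [o1 r1 e1] := IHa2 j c okc c0 ltac:(lia).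
    have [o2 r2 e2] := IHb1 ltac:(lia).
    rewrite o1 o2 r1 r2; split; [lia|lia|].
    by apply: den_eq_trans (den_eq_before _ oka okc' _ _ c0); [exact: den_eq_int|lia|lia].
  case: (ltnP j (i + rank rk b)) => jb /=; last first.
    have [o1 r1 e1] := IHa2 (j - rank rk b).+1 c okc c0 ltac:(lia).
    have [o2 r2 e2] := IHb1 ltac:(lia).
    rewrite o1 o2 r1 r2; split; [lia|lia|].
    by apply: den_eq_trans (den_eq_after _ oka okb _ _); [exact: den_eq_int|lia|lia].
  have [o2 r2 e2] := IHb2 (j - i).+1 c okc c0 ltac:(lia).
  have e3 : den_eq (TInt i a (TInt (j - i).+1 b c)) (TInt j (TInt i a b) c).
    by apply: (den_eq_inside _ oka okb); lia.
  (* If [a] has rank [k], then [b] has rank exactly 1; filled with [c] it has rank 0 and can be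
     pushed into [a] in turn. *)
  case: eqP => rak /=.
    have [o1 r1 e1] := IHa2 i _ o2 ltac:(lia) iP.
    split=> //; first by lia.
    apply: den_eq_trans e3; apply: den_eq_trans e1 _; exact: den_eq_int.
  have [o1 r1 e1] := IHa1 ltac:(lia).
  rewrite o1 o2 r1 r2; split; [lia|lia|].
  apply: den_eq_trans e3; exact: den_eq_int.
Qed.

End Lowering.

(** * Substitution of finite sets of terms for nonterminals *)

Section Expansion.
Variable N : finType.
Implicit Types (t s : term Sigma N) (c : N -> seq (term Sigma N)).

Fixpoint expand c (t : term Sigma N) : seq (term Sigma N) :=
  match t with
  | TN A => c A
  | TW w => [:: TW w]
  | TOne => [:: TOne]
  | TCat a b => [seq TCat x y | x <- expand c a, y <- expand c b]
  | TInt j a b => [seq TInt j x y | x <- expand c a, y <- expand c b]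
  end.

Lemma expand_ok rk h h' K c t s :
  (forall A s, s \in c A -> rank rk s = rk A /\ ok rk h K s) ->
  ok rk h' K t -> s \in expand c t -> rank rk s = rank rk t /\ ok rk h K s.
Proof.
move=> hc; elim: t s => [A|w||a IHa b IHb|j a IHa b IHb] s /=; first by move=> _ /hc.
- by move=> K0; rewrite mem_seq1 => /eqP ->.
- by move=> K0; rewrite mem_seq1 => /eqP ->.
- case/and3P=> oa ob rab /allpairsP [[x y] /= [/(IHa _ oa) [rx ox] /(IHb _ ob) [ry oy] ->]].
  by rewrite /= ox oy rx ry.
- case/and4P=> oa ob jP rab /allpairsP [[x y] /= [/(IHa _ oa) [rx ox] /(IHb _ ob) [ry oy] ->]].
  by rewrite /= ox oy rx ry jP.
Qed.

(** Each occurrence of a nonterminal chooses its replacement independently, which matches the union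
    of the denotations at each leaf. *)
Lemma expandP rho c t v :
  (exists2 s, s \in expand c t & den rho s v) <->
  den (fun A u => exists2 s, s \in c A & den rho s u) t v.
Proof.
elim: t v => [A|w||a IHa b IHb|j a IHa b IHb] v //=.
- by split=> [[s]|->]; [rewrite mem_seq1 => /eqP ->|exists (TW w); rewrite ?mem_seq1].
- by split=> [[s]|->]; [rewrite mem_seq1 => /eqP ->|exists TOne; rewrite ?mem_seq1].
- split=> [[_ /allpairsP [[x y] /= [xa yb ->]] [u1 [u2 [d1 d2 ->]]]]|].
    by exists u1, u2; split=> //; [apply/IHa; exists x|apply/IHb; exists y].
  case=> u1 [u2 [/IHa [x xa d1] /IHb [y yb d2] ->]].
  by exists (TCat x y); [apply/allpairsP; exists (x, y)|exists u1, u2].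
- split=> [[_ /allpairsP [[x y] /= [xa yb ->]] [u1 [u2 [d1 d2 ->]]]]|].
    by exists u1, u2; split=> //; [apply/IHa; exists x|apply/IHb; exists y].
  case=> u1 [u2 [/IHa [x xa d1] /IHb [y yb d2] ->]].
  by exists (TInt j x y); [apply/allpairsP; exists (x, y)|exists u1, u2].
Qed.

End Expansion.

Lemma size_intercal j (u v : word) : size (intercal j u v) <= size u + size v.
Proof.
by elim: u j => [|[|a] u IH] j //=; [case: eqP => _; rewrite ?size_cat /=; have := IH j.-1; lia|
  have := IH j; lia].
Qed.

(** * The induction step *)

Section Level.
Variables (N : finType) (rk : N -> nat) (k : nat) (T : N -> seq (term Sigma N)).
Hypotheses (wfT : wf rk k.+1 T) (flatT : forall A t, t \in T A -> flat t).

(** High nonterminals are unfolded to depth at most [d]; choices exceeding the depth are discarded.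
    Only low nonterminals remain as leaves. *)
Fixpoint unfoldings (d : nat) (A : N) : seq (term Sigma N) :=
  if rk A < k then [:: TN A]
  else if d is d.+1 then flatten [seq expand (unfoldings d) t | t <- T A] else [::].

Lemma unfoldings_low d A : rk A < k -> unfoldings d A = [:: TN A].
Proof. by case: d => /= [|d] ->. Qed.

(** Depth [#|N|] suffices for paths on which no high nonterminal repeats. High nonterminals get no
    rules, since unfolding has removed them. *)
Definition low_rules (A : N) : seq (term Sigma N) :=
  if rk A < k then
    [seq norm rk k None s | s <- flatten [seq expand (unfoldings #|N|) t | t <- T A]]
  else [::].

Lemma unfoldings_ok d A s : s \in unfoldings d A -> rank rk s = rk A /\ ok rk k k.+1 s.
Proof.
elim: d A s => [|d IH] A s /=; case: ifP => // Ak.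
- by rewrite mem_seq1 => /eqP -> /=; rewrite Ak ltnS ltnW.
- by rewrite mem_seq1 => /eqP -> /=; rewrite Ak ltnS ltnW.
case/flattenP=> _ /mapP [t tA ->]; have [<- okt] := wfT tA.
exact: (expand_ok IH okt).
Qed.

Lemma low_rulesP A s : s \in low_rules A ->
  exists t s', [/\ rk A < k, t \in T A, s' \in expand (unfoldings #|N|) t & s = norm rk k None s'].
Proof.
rewrite /low_rules; case: ifP => // Ak /mapP [s' /flattenP [_ /mapP [t tA ->] s't] ->].
by exists t, s'.
Qed.

Lemma low_rules_wf : wf rk k low_rules.
Proof.
move=> A s /low_rulesP [t [s' [Ak tA s't ->]]]; have [rt okt] := wfT tA.
have [rs oks] := expand_ok (@unfoldings_ok _) okt s't.
(* Only ranks and [ok] are wanted here, so the empty interpretation serves. *)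
have [|[] //] := @norm_spec _ rk k (fun _ _ => False) _ _ oks; first by [].
  by rewrite rs rt.
by rewrite rs rt.
Qed.

Lemma unfoldings_sound d A s v :
  s \in unfoldings d A -> den (lang_of T) s v -> lang_of T A v.
Proof.
elim: d A s v => [|d IH] A s v /=; case: ifP => // Ak.
- by rewrite mem_seq1 => /eqP ->.
- by rewrite mem_seq1 => /eqP ->.
case/flattenP=> _ /mapP [t tA ->] st ds; apply: (lang_ofI tA).
have /expandP : exists2 s, s \in expand (unfoldings d) t & den (lang_of T) s v by exists s.
by apply: den_mono => B u [s' s'B]; apply: IH s'B.
Qed.

Lemma low_rules_den rho A s' t : (forall A u, rho A u -> wrank u = rk A) ->
  rk A < k -> t \in T A -> s' \in expand (unfoldings #|N|) t ->
  den_eq rho (norm rk k None s') s'.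
Proof.
move=> hr Ak tA s't; have [rt okt] := wfT tA.
have [rs oks] := expand_ok (@unfoldings_ok _) okt s't.
have [lowP _] := norm_spec hr oks; have [|_ _ e] := lowP; last by [].
by rewrite rs rt.
Qed.

Lemma low_rules_sound A v : lang_of low_rules A v -> lang_of T A v.
Proof.
case=> m; elim: m A v => //= m IH A v [s /low_rulesP [t [s' [Ak tA s't ->]]]].
move/(low_rules_den (fun B u => lang_upto_rank (m := m) low_rules_wf) Ak tA s't) => ds.
apply: (lang_ofI tA).
have /expandP : exists2 s, s \in expand (unfoldings #|N|) t & den (lang_of T) s v.
  by exists s' => //; apply: den_mono ds.
by apply: den_mono => B u [s1 s1B]; apply: unfoldings_sound s1B.
Qed.

Definition unfolded (d : nat) (A : N) (v : word) : Prop :=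
  exists2 s, s \in unfoldings d A & den (lang_of low_rules) s v.

Lemma unfolded_sound d A v : unfolded d A v -> lang_of T A v.
Proof.
case=> s sA ds; apply: unfoldings_sound sA _.
by apply: den_mono ds; apply: low_rules_sound.
Qed.

Lemma unfolded_high d A t v :
  t \in T A -> rk A = k -> den (unfolded d) t v -> unfolded d.+1 A v.
Proof.
move=> tA Ak /expandP [s st ds]; exists s => //=; rewrite Ak ltnn.
by apply/flattenP; exists (expand (unfoldings d) t); rewrite ?map_f.
Qed.

(** A low nonterminal unfolds only to itself, for every [d], so the depth count starts afresh below
    it. *)
Lemma unfolded_low d A t v :
  t \in T A -> rk A < k -> den (unfolded #|N|) t v -> unfolded d A v.
Proof.
move=> tA Ak /expandP [s st ds]; exists (TN A); first by rewrite unfoldings_low ?mem_head.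
apply: (lang_ofI (t := norm rk k None s)).
  rewrite /low_rules Ak map_f //; apply/flattenP.
  by exists (expand (unfoldings #|N|) t); rewrite ?map_f.
by apply/(low_rules_den (fun B u => lang_of_rank low_rules_wf) Ak tA st).
Qed.

(** * Length bounds and repetitions, given a pumping constant [n1] of the lowered grammar *)

Section Bounds.
Variable n1 : nat.
Hypothesis n1P : forall A v,
  lang_of low_rules A v -> n1 < size v -> pumpable k n1 (lang_of low_rules A) v.

Fixpoint leaf_bound (t : term Sigma N) : nat :=
  match t with
  | TN _ => n1
  | TW w => size w
  | TOne => 1
  | TCat a b | TInt _ a b => leaf_bound a + leaf_bound b
  end.

(** A leaf word longer than [n1] is pumpable, and the term around it is a pump context. Otherwise
    all leaves are short and their lengths add up. *)
Lemma den_leaf_bound h K t v : ok rk h K t -> den (lang_of low_rules) t v ->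
  size v <= leaf_bound t \/ pumpable k n1 (den (lang_of low_rules) t) v.
Proof.
elim: t v => [A|w||a IHa b IHb|j a IHa b IHb] v /=.
- by move=> _ lv; case: leqP => nv; [left|right; apply: n1P].
- by move=> _ ->; left; rewrite size_map.
- by move=> _ ->; left.
- case/and3P=> oka okb _ [u1 [u2 [d1 d2 ->]]].
  case: (IHa _ oka d1) => [s1|p1]; last first.
    right; apply: (pumpable_context (pump_context_catr u2)) p1 => u du.
    by exists u, u2.
  case: (IHb _ okb d2) => [s2|p2]; last first.
    right; apply: (pumpable_context (pump_context_catl u1)) p2 => u du.
    by exists u1, u.
  by left; rewrite size_cat leq_add.
- case/and4P=> oka okb jP _ [u1 [u2 [d1 d2 ->]]].
  case: (IHa _ oka d1) => [s1|p1]; last first.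
    right; apply: (pumpable_context (pump_context_intercalr j u2)) p1 => u du.
    by exists u, u2.
  case: (IHb _ okb d2) => [s2|p2]; last first.
    right; have jP' : 0 < j <= wrank u1.
      by rewrite (den_rank (fun B u => lang_of_rank low_rules_wf) oka d1).
    apply: (pumpable_context (pump_context_intercall jP')) p2 => u du.
    by exists u1, u.
  by left; apply: leq_trans (size_intercal _ _ _) _; rewrite leq_add.
Qed.

Definition unfolded_bound : nat :=
  \max_(d < #|N|.+1) \max_(A : N) \max_(s <- unfoldings d A) leaf_bound s.

Lemma unfolded_size d A v : d <= #|N| -> unfolded d A v ->
  size v <= unfolded_bound \/ pumpable k n1 (lang_of T A) v.
Proof.
move=> dN [s sA ds]; have [_ oks] := unfoldings_ok sA.
case: (den_leaf_bound oks ds) => [sv|p]; [left|right].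
  apply: leq_trans sv _; rewrite -ltnS in dN.
  apply: leq_trans (leq_bigmax (Ordinal dN)) => /=.
  apply: leq_trans (leq_bigmax A) => /=.
  exact: (leq_bigmax_seq (P := xpredT)).
apply: pumpable_sub p => // u du; by apply: (@unfolded_sound d); exists s.
Qed.

(** A flat rule joins at most two words, so each step up a path at least doubles the bound; [d] will
    count the nonterminals not yet on the path. *)
Fixpoint chain_bound (d : nat) : nat :=
  if d is d.+1 then unfolded_bound + chain_bound d + chain_bound d else unfolded_bound.

Lemma chain_bound_mono d d' : d <= d' -> chain_bound d <= chain_bound d'.
Proof.
move=> dd; rewrite -(subnK dd); elim: (d' - d) => //= e IH; lia.
Qed.

Lemma unfolded_chain_bound d : unfolded_bound <= chain_bound d.
Proof. by case: d => //= d; lia. Qed.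

Definition level_bound : nat := n1 + chain_bound #|N|.

Lemma pumpable_level (L : word -> Prop) v : pumpable k n1 L v -> pumpable k.+1 level_bound L v.
Proof. by apply: pumpable_sub => //; rewrite leq_addr. Qed.

(** Any word of [B] may replace [x]; once [L] is the language of [B] itself, the map [f] can be
    iterated inside it. *)
Definition chain (L : word -> Prop) (F : {set N}) m v z := exists B f x,
  [/\ B \in F, rk B = k, even_map f & v = f x] /\
  [/\ lang_upto T m B x, forall u, lang_of T B u -> L (f u) & size v <= z].

(* [F] is the set of nonterminals on the path of rank-[k] nodes leading down to
   the root of the current derivation; the third alternative is a rank-[k] path
   from this root to a nonterminal of [F], which will close a repetition above. *)
Definition outcome (F : {set N}) m A v :=
  [\/ pumpable k.+1 level_bound (lang_of T A) v, unfolded #|~: F| A v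
    | rk A = k /\ chain (lang_of T A) F m v (chain_bound #|~: F|)].

Lemma outcome_size F m A v : outcome F m A v ->
  pumpable k.+1 level_bound (lang_of T A) v \/ size v <= chain_bound #|~: F|.
Proof.
case=> [p|D|[_ [B [f [x [_ [_ _ sv]]]]]]]; [by left| |by right].
case: (unfolded_size _ D) => [|sv|p]; first exact: max_card.
  by right; apply: leq_trans sv (unfolded_chain_bound _).
by left; apply: pumpable_level.
Qed.

Lemma chain_comp (L L' : word -> Prop) F m v z g z' :
  even_map g -> (forall u, L u -> L' (g u)) -> size (g v) <= z' ->
  chain L F m v z -> chain L' F m (g v) z'.
Proof.
move=> eg LL sg [B [f [x [[BF Bk ef ve] [Bx Lf _]]]]].
exists B, (g \o f), x; split; split=> //; first exact: even_map_comp.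
  by rewrite /= -ve.
by move=> u /Lf /LL.
Qed.

(** A pumpable operand is lifted through the operation, and two unfolded operands give an unfolded
    term. If one operand carries a chain, it has rank [k]; when the term also has rank [k], the
    other operand has rank 0 in a concatenation and 1 in an intercalation, so the context is
    even. *)
Lemma rule_outcome F m t v :
  (forall B u, lang_upto T m B u -> outcome F m B u) ->
  flat t -> ok rk k.+1 k.+1 t -> rank rk t = k \/ F = set0 -> den (lang_upto T m) t v ->
  [\/ pumpable k.+1 level_bound (den (lang_of T) t) v, den (unfolded #|~: F|) t v
    | rank rk t = k /\ chain (den (lang_of T) t) F m v (chain_bound #|~: F|.+1)].
Proof.
move=> IH.
have Tk B u : lang_upto T m B u -> wrank u = rk B by apply: lang_upto_rank wfT.
have up B u : lang_upto T m B u -> lang_of T B u by exists m.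
case: t => [A|w||a b|j a b] ft okt rtF.
- move=> /= /IH [p|D|[Ak [B [f [x [h1 [h2 h3 sv]]]]]]]; [by constructor 1|by constructor 2|].
  constructor 3; split=> //; exists B, f, x; split=> //; split=> //.
  by move: sv => /=; lia.
- by constructor 2.
- by constructor 2.
- case: a b ft okt rtF => // p [] // r _ /= /and3P[_ _ rpr] rtF [u1 [u2 [d1 d2 ->]]].
  have liftl : pumpable k.+1 level_bound (lang_of T p) u1 ->
      pumpable k.+1 level_bound (den (lang_of T) (TCat (TN p) (TN r))) (u1 ++ u2).
    apply: (pumpable_context (pump_context_catr u2)) => u du.
    by exists u, u2; split=> //; apply: up.
  have liftr : pumpable k.+1 level_bound (lang_of T r) u2 ->
      pumpable k.+1 level_bound (den (lang_of T) (TCat (TN p) (TN r))) (u1 ++ u2).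
    apply: (pumpable_context (pump_context_catl u1)) => u du.
    by exists u1, u; split=> //; apply: up.
  case: (outcome_size (IH _ _ d1)) => [/liftl ?|s1]; first by constructor 1.
  case: (outcome_size (IH _ _ d2)) => [/liftr ?|s2]; first by constructor 1.
  have s12 : size (u1 ++ u2) <= chain_bound #|~: F|.+1 by rewrite size_cat /=; lia.
  case: (IH _ _ d1) => [/liftl ?|D1|[pk c1]]; first by constructor 1.
    case: (IH _ _ d2) => [/liftr ?|D2|[rk_r c2]]; first by constructor 1.
      by constructor 2; exists u1, u2.
    constructor 3; split; first by lia.
    apply: (chain_comp (g := cat u1)) c2 => //.
      by apply: even_map_catl; rewrite (Tk _ _ d1); lia.
    by move=> u du; exists u1, u; split=> //; apply: up.
  constructor 3; split; first by lia.
  apply: (chain_comp (g := cat^~ u2)) c1 => //.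
    by apply: even_map_catr; rewrite (Tk _ _ d2); lia.
  by move=> u du; exists u, u2; split=> //; apply: up.
- case: a b ft okt rtF => // p [] // r _ /= /and4P[_ _ jP rpr] rtF [u1 [u2 [d1 d2 ->]]].
  have jP' : 0 < j <= wrank u1 by rewrite (Tk _ _ d1).
  have liftl : pumpable k.+1 level_bound (lang_of T p) u1 ->
      pumpable k.+1 level_bound (den (lang_of T) (TInt j (TN p) (TN r))) (intercal j u1 u2).
    apply: (pumpable_context (pump_context_intercalr j u2)) => u du.
    by exists u, u2; split=> //; apply: up.
  have liftr : pumpable k.+1 level_bound (lang_of T r) u2 ->
      pumpable k.+1 level_bound (den (lang_of T) (TInt j (TN p) (TN r))) (intercal j u1 u2).
    apply: (pumpable_context (pump_context_intercall jP')) => u du.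
    by exists u1, u; split=> //; apply: up.
  case: (outcome_size (IH _ _ d1)) => [/liftl ?|s1]; first by constructor 1.
  case: (outcome_size (IH _ _ d2)) => [/liftr ?|s2]; first by constructor 1.
  have s12 : size (intercal j u1 u2) <= chain_bound #|~: F|.+1.
    by apply: leq_trans (size_intercal _ _ _) _ => /=; lia.
  (* A chain ends in [F], which is then nonempty; this leaves only the case of a term of rank
     [k]. *)
  have Fk L v' z : chain L F m v' z -> (rk p + rk r).-1 = k.
    by case: rtF => // -> [B [f [x [[]]]]]; rewrite inE.
  case: (IH _ _ d1) => [/liftl ?|D1|[pk c1]]; first by constructor 1.
    case: (IH _ _ d2) => [/liftr ?|D2|[rk_r c2]]; first by constructor 1.
      by constructor 2; exists u1, u2.
    have := Fk _ _ _ c2; constructor 3; split; first by lia.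
    apply: (chain_comp (g := intercal j u1)) c2 => //.
      by apply: even_map_intercall; rewrite ?(Tk _ _ d1); lia.
    by move=> u du; exists u1, u; split=> //; apply: up.
  have := Fk _ _ _ c1; constructor 3; split; first by lia.
  apply: (chain_comp (g := (intercal j)^~ u2)) c1 => //.
    by apply: even_map_intercalr; rewrite ?(Tk _ _ d2); lia.
  by move=> u du; exists u, u2; split=> //; apply: up.
Qed.

Lemma outcome_up F m A v : outcome F m A v -> outcome F m.+1 A v.
Proof.
case=> [p|D|[Ak [B [f [x [h1 [h2 h3 sv]]]]]]]; [by constructor 1|by constructor 2|].
constructor 3; split=> //; exists B, f, x; split=> //; split=> //.
exact: lang_upto_mono h2.
Qed.

(** Below a low nonterminal the path restarts empty; a high one is added to it. A chain that comes
    back to [A] gives a pump, unless [f x = x]: then [v] is derivable with smaller height and the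
    induction hypothesis applies to it. *)
Lemma outcome_new (F : {set N}) m A v :
  (forall F B u, lang_upto T m B u -> outcome F m B u) ->
  rk A < k \/ A \notin F -> lang_upto T m.+1 A v -> outcome F m.+1 A v.
Proof.
move=> IH AF [t tA dt]; have [rt okt] := wfT tA; have rtk := ok_rank okt.
have [Ak|Ak] := ltnP (rk A) k.
  have [p|D|[rk_t _]] := rule_outcome (IH set0) (flatT tA) okt (or_intror erefl) dt.
  - by constructor 1; apply: pumpable_sub p => // u; apply: lang_ofI.
  - constructor 2; apply: (unfolded_low _ tA Ak).
    by move: D; rewrite setC0 cardsT.
  - by move: Ak; rewrite -rt rk_t ltnn.
have {}Ak : rk A = k by apply/eqP; rewrite eqn_leq Ak andbT -ltnS -rt.
have {}AF : A \notin F by case: AF => //; rewrite Ak ltnn.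
(* Adding [A] to the path uses one unit of depth, which pays for one more unfolding or one more step
   of [chain_bound]. *)
have cF : #|~: F| = #|~: (A |: F)|.+1.
  by rewrite (cardsD1 A (~: F)) inE AF setCU setIC setDE.
have rtA : rank rk t = k \/ A |: F = set0 by left; rewrite rt.
have [p|D|[_ [B [f [x [[BF Bk ef ve] [Bx Lf sv]]]]]]] :=
  rule_outcome (IH (A |: F)) (flatT tA) okt rtA dt.
- by constructor 1; apply: pumpable_sub p => // u; apply: lang_ofI.
- by constructor 2; rewrite cF; apply: unfolded_high D.
have Lf' u : lang_of T B u -> lang_of T A (f u) by move/Lf; apply: lang_ofI.
rewrite -cF in sv; move: BF; rewrite in_setU1 => /orP[/eqP BA|BF]; last first.
  constructor 3; split=> //; exists B, f, x; split=> //; split=> //.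
  exact: lang_upto_mono Bx.
subst B; have Lx : lang_of T A x by exists m.
have xk : wrank x < k.+1 by rewrite (lang_upto_rank wfT Bx) Ak.
have fb : size (f x) <= level_bound.
  rewrite -ve; apply: leq_trans sv _; apply: leq_trans (chain_bound_mono (max_card _)) _.
  exact: leq_addl.
have [fx|p] := pumpable_even_map ef xk fb Lx Lf'; last by constructor 1; rewrite ve.
by rewrite ve fx; apply/outcome_up/IH.
Qed.

(** If a high [A] is already in [F], a first analysis with the empty path shows that [v] is pumpable
    or short. In the latter case [v] itself starts a chain, with the identity as context, and the
    repetition is closed higher up. *)
Lemma outcomeP (F : {set N}) m A v : lang_upto T m A v -> outcome F m A v.
Proof.
elim: m F A v => // m IH F A v lv; have [Ak|Ak] := ltnP (rk A) k.
  by apply: outcome_new => //; left.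
have {}Ak : rk A = k.
  by case: lv => t /wfT [rt /ok_rank]; rewrite rt ltnS => Ak' _; apply/eqP; rewrite eqn_leq Ak'.
have [AF|AF] := boolP (A \in F); last by apply: outcome_new => //; right.
have [p|D|[_ [B [f [x [[]]]]]]] : outcome set0 m.+1 A v; last by rewrite inE.
- by apply: outcome_new => //; right; rewrite inE.
- by constructor 1.
case: (unfolded_size _ D) => [|sv|p]; first exact: max_card.
  constructor 3; split=> //; exists A, id, v; split; split=> //; first exact: even_map_id.
  by apply: leq_trans sv (unfolded_chain_bound _).
by constructor 1; apply: pumpable_level.
Qed.

Lemma level_pumpable A v :
  lang_of T A v -> level_bound < size v -> pumpable k.+1 level_bound (lang_of T A) v.
Proof.
case=> m lv nv; case: (outcome_size (outcomeP set0 lv)) => // sv.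
by move: nv; rewrite ltnNge (leq_trans sv) // setC0 cardsT leq_addl.
Qed.

End Bounds.
End Level.

(** The grammar is general in the induction on [K], because the step passes to the lowered form of
    the flattened grammar, which has other nonterminals and need not be flat. *)
Lemma wf_pumpable K (N : finType) (rk : N -> nat) (T : N -> seq (term Sigma N)) :
  wf rk K T ->
  exists n, forall A v, lang_of T A v -> n < size v -> pumpable K n (lang_of T A) v.
Proof.
elim: K N rk T => [|k IH] N rk T wfT.
  (* For [K = 0] a right-hand side would have rank below 0, so all languages are empty. *)
  by exists 0 => A v [[|m]] //= [t /wfT [_ /ok_rank]].
have wfF := flat_rules_wf wfT.
have [n1 n1P] := IH _ _ _ (low_rules_wf wfF).
have flF := @flat_rules_flat _ T.
exists (level_bound (flat_rank rk (T := T)) k (flat_rules (T := T)) n1) => A v.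
move=> /flat_embedP lv nv; have := level_pumpable wfF flF n1P lv nv.
by apply: pumpable_sub => // u /flat_embedP.
Qed.

(** * Derivations as least fixed points *)

Section FromDefs.
Variables (N : finType) (P : seq (N * term Sigma N)).

Definition rules_of (A : N) : seq (term Sigma N) := [seq r.2 | r <- P & r.1 == A].

Lemma rules_ofP A t : t \in rules_of A <-> List.In (A, t) P.
Proof.
rewrite /rules_of; elim: P => //= [[B s] P' IH]; split.
  case: ifP => [/eqP /= ->|_ /IH]; last by right.
  by rewrite in_cons => /orP[/eqP ->|/IH]; [left|right].
case=> [[-> ->]|/IH tA]; first by rewrite eqxx mem_head.
by case: ifP => // _; rewrite in_cons tA orbT.
Qed.

(** A derivation is read backwards: the value of its ground term is carried through each step to the
    start symbol. *)
Lemma step_den s t v : step P s t -> den (lang_of rules_of) t v -> den (lang_of rules_of) s v.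
Proof.
move=> st; elim: st v => /=.
- by move=> B b /rules_ofP bB v; apply: lang_ofI.
- by move=> a a' b _ IH v [u1 [u2 [/IH d1 d2 ->]]]; exists u1, u2.
- by move=> a b b' _ IH v [u1 [u2 [d1 /IH d2 ->]]]; exists u1, u2.
- by move=> j a a' b _ IH v [u1 [u2 [/IH d1 d2 ->]]]; exists u1, u2.
- by move=> j a b b' _ IH v [u1 [u2 [d1 /IH d2 ->]]]; exists u1, u2.
Qed.

Lemma ground_den rho (t : term Sigma N) : ground t -> den rho t (value t).
Proof.
elim: t => //= [a IHa b IHb|j a IHa b IHb] [/IHa da /IHb db];
by exists (value a), (value b).
Qed.

Lemma derives_cat (t t' s s' : term Sigma N) :
  clos_refl_trans _ (step P) t t' -> clos_refl_trans _ (step P) s s' ->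
  clos_refl_trans _ (step P) (TCat t s) (TCat t' s').
Proof.
move=> tt' ss'; apply: (@rt_trans _ _ _ (TCat t' s)).
  elim: tt' => [x y xy|x|x y z _ IH1 _ IH2]; [by apply/rt_step/st_catl|exact: rt_refl|].
  exact: rt_trans IH1 IH2.
elim: ss' => [x y xy|x|x y z _ IH1 _ IH2]; [by apply/rt_step/st_catr|exact: rt_refl|].
exact: rt_trans IH1 IH2.
Qed.

Lemma derives_int j (t t' s s' : term Sigma N) :
  clos_refl_trans _ (step P) t t' -> clos_refl_trans _ (step P) s s' ->
  clos_refl_trans _ (step P) (TInt j t s) (TInt j t' s').
Proof.
move=> tt' ss'; apply: (@rt_trans _ _ _ (TInt j t' s)).
  elim: tt' => [x y xy|x|x y z _ IH1 _ IH2]; [by apply/rt_step/st_intl|exact: rt_refl|].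
  exact: rt_trans IH1 IH2.
elim: ss' => [x y xy|x|x y z _ IH1 _ IH2]; [by apply/rt_step/st_intr|exact: rt_refl|].
exact: rt_trans IH1 IH2.
Qed.

Definition derives_word (t : term Sigma N) (v : word) : Prop :=
  exists s, [/\ clos_refl_trans _ (step P) t s, ground s & value s = v].

(** Derivations from the two operands of a term run independently and are then composed. *)
Lemma den_derives (rho : N -> word -> Prop) (t : term Sigma N) v :
  (forall A u, rho A u -> derives_word (TN A) u) -> den rho t v -> derives_word t v.
Proof.
move=> hr; elim: t v => [A|w||a IHa b IHb|j a IHa b IHb] v /=; first exact: hr.
- by move=> ->; exists (TW w); split=> //; apply: rt_refl.
- by move=> ->; exists TOne; split=> //; apply: rt_refl.
- case=> u1 [u2 [/IHa [s [ds gs <-]] /IHb [r [dr gr <-]] ->]].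
  by exists (TCat s r); split=> //; apply: derives_cat.
- case=> u1 [u2 [/IHa [s [ds gs <-]] /IHb [r [dr gr <-]] ->]].
  by exists (TInt j s r); split=> //; apply: derives_int.
Qed.

Lemma lang_upto_derives m A v : lang_upto rules_of m A v -> derives_word (TN A) v.
Proof.
elim: m A v => //= m IH A v [t /rules_ofP tA /(den_derives IH) [s [ts gs vs]]].
by exists s; split=> //; apply: rt_trans ts; apply: rt_step; constructor.
Qed.

Lemma langP A w : lang P A w <-> lang_of rules_of A (map (@Sym Sigma) w).
Proof.
split=> [[t [der gt vt]]|[m /lang_upto_derives [s [ds gs vs]]]]; last by exists s.
suff : den (lang_of rules_of) (TN A) (map (@Sym Sigma) w) by [].
move: (ground_den (lang_of rules_of) gt); rewrite vt.
elim: der (map _ _) => [x y xy v|//|x y z _ IH1 _ IH2 v]; first exact: step_den.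
by move=> /IH2 /IH1.
Qed.

(** The bound on the rank of [t] excludes [TOne], which is [correct] and of rank 1 even when
    [k = 0]. *)
Lemma correct_ok (rk : N -> nat) k (t : term Sigma N) :
  (forall A, rk A <= k) -> correct rk k t -> rank rk t <= k -> ok rk k.+1 k.+1 t.
Proof.
move=> rkk; elim: t => [A|w||a IHa b IHb|j a IHa b IHb] //=.
- by move=> _ h; rewrite !ltnS h.
- by case=> ca cb rab _; rewrite IHa ?IHb //; lia.
(* As [j] is positive, [a] has positive rank, which bounds the rank of [b]. For [a] itself the bound
   comes from its top node; if this is [TOne], from [1 <= j <= k]. *)
case=> ca cb jk ja rab rt; have ra : rank rk a <= k.
  case: {IHa} a ca ja rab rt => //= [|a1 a2 [] //|i a1 a2 [_ _ _ _ h]]; lia.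
by rewrite IHa ?IHb //; lia.
Qed.

Lemma kDCFG_wf (rk : N -> nat) k S : is_kDCFG rk k P S -> wf rk k.+1 rules_of.
Proof.
case=> rkk _ hP A t /rules_ofP /hP [rt ct]; split=> //.
by apply: correct_ok => //; rewrite rt.
Qed.

End FromDefs.

End Grammars.

(** * Return to words without separators *)

Section Erasure.
Variable Sigma : Type.
Notation word := (seq (sym Sigma)).

Definition erase_sep (u : word) : seq Sigma :=
  pmap (fun a => if a is Sym x then Some x else None) u.

Lemma erase_sep_map w : erase_sep (map (@Sym Sigma) w) = w.
Proof. by elim: w => //= a w ->. Qed.

Lemma map_erase_sep u : wrank u = 0 -> map (@Sym Sigma) (erase_sep u) = u.
Proof. by elim: u => [|[|a] u IH] //= /IH ->. Qed.

Lemma size_erase_sep u : wrank u = 0 -> size (erase_sep u) = size u.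
Proof. by move=> u0; rewrite -[in RHS](map_erase_sep u0) size_map. Qed.

Lemma erase_sep_cat u v : erase_sep (u ++ v) = erase_sep u ++ erase_sep v.
Proof. exact: pmap_cat. Qed.

Lemma erase_sep_pow p u :
  erase_sep (flatten (nseq p u)) = flatten (nseq p (erase_sep u)).
Proof. by elim: p => //= p IH; rewrite erase_sep_cat IH. Qed.

Definition erase_quad (q : word * word * word * word) :=
  (erase_sep (part_y q), erase_sep (part_u q), erase_sep (part_z q), erase_sep (part_s q)).

Lemma erase_sep_pump s0 parts p :
  erase_sep (pump s0 parts p) = pump (erase_sep s0) (map erase_quad parts) p.
Proof.
elim: parts s0 => [|q parts IH] s0; first by rewrite /pump /= erase_sep_cat.
by rewrite map_cons !pump_cons 4!erase_sep_cat !erase_sep_pow IH.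
Qed.

End Erasure.

Theorem theorem3 (k : nat) (Sigma : finType) (L : seq Sigma -> Prop) :
  is_kDCFL k L ->
  exists n : nat, forall w : seq Sigma, L w -> n < size w ->
    exists (s0 : seq Sigma) (parts : seq (seq Sigma * seq Sigma * seq Sigma * seq Sigma)),
      [/\ size parts <= k.+1,
          w = s0 ++ flatten (map (fun q => part_y q ++ part_u q ++ part_z q ++ part_s q) parts),
          0 < sumn (map (fun q => size (part_y q) + size (part_z q)) parts),
          sumn (map (fun q => size (part_y q) + size (part_u q) + size (part_z q)) parts) <= n
        & forall p : nat, L (pump s0 parts p)].
Proof.
case=> N [rk [P [S [gP LP]]]]; have wfP := kDCFG_wf gP.
have [n nP] := wf_pumpable wfP.
exists n => w /LP /langP lw nw.
have [|s0 [parts [[sp fr wE] [yz yuz Lp]]]] := nP _ _ lw; first by rewrite size_map.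
have sz q : sepfree q -> [/\ size (part_y (erase_quad q)) = size (part_y q),
    size (part_u (erase_quad q)) = size (part_u q)
    & size (part_z (erase_quad q)) = size (part_z q)].
  by case/and3P=> /eqP y0 /eqP u0 /eqP z0; rewrite !size_erase_sep.
exists (erase_sep s0), (map (@erase_quad Sigma) parts); split.
- by rewrite size_map.
- rewrite -(erase_sep_map w) wE erase_sep_pump /pump; congr (_ ++ flatten _).
  (* A single repetition is [flatten (nseq 1 y)], which computes to [y ++ [::]]. *)
  by apply: eq_map => q; rewrite /= !cats0.
- suff -> : [seq size (part_y q) + size (part_z q) | q <- map (@erase_quad Sigma) parts] =
    [seq size (part_y q) + size (part_z q) | q <- parts] by [].
  rewrite -map_comp; elim: parts fr {sp wE yz yuz Lp} => //= q parts IH /andP[/sz [-> _ ->] /IH ->].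
  by [].
- suff -> : [seq size (part_y q) + size (part_u q) + size (part_z q)
              | q <- map (@erase_quad Sigma) parts] =
    [seq size (part_y q) + size (part_u q) + size (part_z q) | q <- parts] by [].
  rewrite -map_comp; elim: parts fr {sp wE yz yuz Lp} => //=.
  move=> q parts IH /andP[/sz [-> -> ->] /IH ->].
  by [].
(* Every pumped word has the rank of [S], which is 0, so erasing its separators loses nothing. *)
- move=> p; apply/LP/langP; rewrite -erase_sep_pump map_erase_sep //.
  by rewrite (lang_of_rank wfP (Lp p)); case: gP.
Qed.
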